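(* Assume that $\theta:D\to A$ is a separated weak factor for the signed carpet $K$, and for $a\in A$ set $N_a=\#\{d\in D:\theta(d)=a\}$. Then $$\dim_{\mathrm H} K=\frac{1}{\log m}\log\left(\sum_{a\in A}N_a^{\beta}\right).$$
   Context: Let $2\le m<n$ be integers, let $D\subset\{0,\ldots,n-1\}\times\{0,\ldots,m-1\}$ be a non-empty digit set, and put $\beta=\log m/\log n$. For each digit $d=(i,j)\in D$ choose signs $\sigma_d,\eta_d\in\{-1,1\}$ and define $$S_d(x,y)=\left(\frac{\sigma_d x+a_d}{n},\frac{\eta_d y+b_d}{m}\right),$$ where $a_d=i$ if $\sigma_d=1$ and $a_d=i+1$ if $\sigma_d=-1$; and $b_d=j$ if $\eta_d=1$ and $b_d=j+1$ if $\eta_d=-1$. The signed carpet $K$ is the attractor of $\{S_d:d\in D\}$, i.e. the unique non-empty compact set $K\subset\mathbb R^2$ with $K=\bigcup_{d\in D}S_d(K)$. The weak-coordinate map associated to $d\in D$ is $g_d(y)=(\eta_d y+b_d)/m$. A map $\theta:D\to A$ onto a finite alphabet $A$ is called a separated weak factor if: (1) there are similarities $g_a$ of $\mathbb R$, $a\in A$, of ratio $1/m$ such that $g_d=g_{\theta(d)}$ for all $d\in D$; and (2) the one-dimensional iterated function system $\{g_a:a\in A\}$ satisfies the open set condition, i.e. there is a non-empty bounded open set $U\subset\mathbb R$ with $g_a(U)\subset U$ for all $a\in A$ and $g_a(U)\cap g_{a'}(U)=\varnothing$ for all $a\neq a'$ in $A$. $\dim_{\mathrm H}$ denotes Hausdorff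 dimension. *)

(* Defs.v *)
From HB Require Import structures.
From mathcomp Require Import all_boot all_order all_algebra.
From mathcomp Require Import all_classical all_reals all_analysis.

Set Implicit Arguments.
Unset Strict Implicit.
Unset Printing Implicit Defensive.

Import Order.TTheory GRing.Theory Num.Theory.
Import numFieldNormedType.Exports.

Local Open Scope classical_set_scope.
Local Open Scope ring_scope.

Section Hausdorff.
Context {R : realType} {T : Type} (dist : T -> T -> R).

(* [ediam set0 = -oo] *)
Definition ediam (E : set T) : \bar R :=
  ereal_sup [set (dist x y)%:E | x in E & y in E].

(* |E|^s; the empty set weighs 0 for every s, so that it may be used to pad
   finite covers, whereas a singleton weighs 1 when s = 0. *)
Definition diam_pow (s : R) (E : set T) : \bar R :=
  if E == set0 then 0%E else poweR (ediam E) s.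

Definition delta_cover (delta : R) (E : set T) (F : (set T)^nat) : Prop :=
  E `<=` \bigcup_i F i /\ forall i, (ediam (F i) <= delta%:E)%E.

Definition hausdorff_content (s delta : R) (E : set T) : \bar R :=
  ereal_inf [set (\sum_(0 <= i <oo) diam_pow s (F i))%E
            | F in [set F | delta_cover delta E F]].

(* The content is nonincreasing in delta: the limit as delta tends to 0 is the
   supremum. *)
Definition hausdorff_measure (s : R) (E : set T) : \bar R :=
  ereal_sup [set hausdorff_content s delta E | delta in [set delta | 0 < delta]].

Definition hausdorff_dim (E : set T) : \bar R :=
  ereal_inf [set s%:E | s in [set s : R | 0 <= s /\ hausdorff_measure s E = 0%E]].

End Hausdorff.

(* The norm of the library on [R * R] is the maximum norm. *)
Definition euclid_dist {R : realType} (p q : R * R) : R :=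
  Num.sqrt ((p.1 - q.1) ^+ 2 + (p.2 - q.2) ^+ 2).

Definition is_attractor {T : topologicalType} {I : finType} (D : {set I})
    (S : I -> T -> T) (K : set T) : Prop :=
  [/\ K !=set0, compact K & K = \bigcup_(d in [set` D]) (S d @` K)].

Section SignedCarpet.
Context {R : realType} {n m : nat}.
Implicit Types (D : {set 'I_n * 'I_m}) (sigma eta : 'I_n * 'I_m -> R).
Implicit Types (d : 'I_n * 'I_m).

Definition is_sign (e : R) : Prop := e = -1 \/ e = 1.

Definition digit_shift (e : R) (k : nat) : R := if e == 1 then k%:R else k.+1%:R.

Definition strong_map sigma d (x : R) : R :=
  (sigma d * x + digit_shift (sigma d) d.1) / n%:R.

Definition weak_map eta d (y : R) : R :=
  (eta d * y + digit_shift (eta d) d.2) / m%:R.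

Definition carpet_map sigma eta d (p : R * R) : R * R :=
  (strong_map sigma d p.1, weak_map eta d p.2).

Definition signed_carpet D sigma eta (K : set (R * R)) : Prop :=
  is_attractor D (carpet_map sigma eta) K.

Definition is_similarity (r : R) (g : R -> R) : Prop :=
  forall x y, `|g x - g y| = r * `|x - y|.

Definition open_set_condition {A : finType} (g : A -> R -> R) : Prop :=
  exists U : set R,
    [/\ U !=set0, bounded_set U, open U,
        forall a, g a @` U `<=` U &
        forall a a', a != a' -> g a @` U `&` g a' @` U = set0].

(* Only the values of [theta] on [D] are used. *)
Definition separated_weak_factor D eta {A : finType}
    (theta : 'I_n * 'I_m -> A) : Prop :=
  (theta @: D)%SET = [set: A]%SET /\
  exists g : A -> R -> R,
    [/\ forall a, is_similarity m%:R^-1 (g a),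
        forall d, d \in D -> weak_map eta d = g (theta d) &
        open_set_condition g].

End SignedCarpet.

(* Main.v *)
Require Import Defs.
From HB Require Import structures.
From mathcomp Require Import all_boot all_order all_algebra.
From mathcomp Require Import all_classical all_reals all_analysis.
From mathcomp Require Import ring lra.

(* Write b = log m / log n and Z = sum_a N_a^b. An approximate square of level
   l is given by the first l digits and by the weak letters (images under theta)
   up to k, where k is about l / b, so that n^-l and m^-k are comparable. Give a
   digit d the weight N_a^(b-1) / Z and a letter a the weight N_a^b / Z, where
   a = theta d. The weight of an approximate square is then
   Z^-k exp (b S_k - S_l), where S_i is the sum of the log N_a over the first i
   letters.

   Upper bound: along l_(j+1) = k(l_j) the averages S_(l_j) / l_j are bounded, so
   that among boundedly many consecutive levels there is one where the average
   almost does not decrease; there the weight is at least Z^-k e^(-eps k). As the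
   weights of the squares of one level add up to 1, the attractor is covered by
   at most Z^k e^(eps k) squares from each of finitely many levels.

   Lower bound: among the weak words of length L a class of words with the same
   letter counts carries Z^L up to a polynomial factor in L. Its words all have
   the same number of lifts, so the uniform weight on the lifts gives a square
   of width delta a mass at most C delta^t with t close to log Z / log m; by the
   separation a set of diameter delta meets boundedly many such squares. By
   compactness only finite covers matter, so counting words of a large fixed
   length replaces the measure on the attractor. *)

Import Order.TTheory GRing.Theory Num.Theory.
Import numFieldNormedType.Exports.

Local Open Scope classical_set_scope.
Local Open Scope ring_scope.

(** * Hausdorff measures and covers *)

Lemma ediam_leP {R : realType} {T : Type} (dist : T -> T -> R) (E : set T)
    (r : R) :
  (ediam dist E <= r%:E)%E <-> forall x y, E x -> E y -> dist x y <= r.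
Proof.
split=> [Er x y Ex Ey|Er].
  rewrite -lee_fin; apply: le_trans Er; apply: ereal_sup_ubound.
  by exists x => //; exists y.
by apply: ge_ereal_sup => _ [x Ex [y Ey <-]]; rewrite lee_fin Er.
Qed.

Lemma ediam_ge0 {R : realType} {T : Type} (dist : T -> T -> R) (E : set T) :
  (forall x, dist x x = 0) -> E !=set0 -> (0 <= ediam dist E)%E.
Proof.
move=> dist0 [x Ex]; apply: ereal_sup_ubound.
by exists x => //; exists x => //; rewrite dist0.
Qed.

Lemma diam_pow_ge0 {R : realType} {T : Type} (dist : T -> T -> R) (s : R)
    (E : set T) : (0 <= diam_pow dist s E)%E.
Proof. by rewrite /diam_pow; case: ifP => // _; exact: poweR_ge0. Qed.

Lemma diam_pow_le {R : realType} {T : Type} (dist : T -> T -> R) (s r : R)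
    (E : set T) :
  (forall x, dist x x = 0) -> 0 <= s -> 0 <= r ->
  (forall x y, E x -> E y -> dist x y <= r) ->
  (diam_pow dist s E <= (r `^ s)%:E)%E.
Proof.
move=> dist0 s0 r0 Er; rewrite /diam_pow; case: eqP => [_|/eqP/set0P E0].
  by rewrite lee_fin powR_ge0.
have d0 := ediam_ge0 _ _ dist0 E0.
have dr : (ediam dist E <= r%:E)%E by apply/ediam_leP.
by rewrite -poweR_EFin; apply: gt0_ler_poweR => //; rewrite in_itv /= ?d0 ?leey //= lee_fin r0.
Qed.

(** Criterion for upper bounds: a finite cover becomes a countable one when padded with empty sets,
    which weigh 0. The numbers [r i] need only bound the diameters from above. *)
Lemma hausdorff_measure_eq0 {R : realType} {T : Type} (dist : T -> T -> R)
    (s : R) (E : set T) :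
  (forall x, dist x x = 0) -> 0 <= s ->
  (forall delta e : R, 0 < delta -> 0 < e ->
    exists (I : finType) (P : pred I) (V : I -> set T) (r : I -> R),
    [/\ E `<=` \bigcup_(i in [set` P]) V i,
        forall i, P i -> 0 <= r i <= delta,
        forall i x y, P i -> V i x -> V i y -> dist x y <= r i &
        \sum_(i | P i) r i `^ s <= e]) ->
  hausdorff_measure dist s E = 0%E.
Proof.
move=> dist0 s0 cov; apply/eqP; rewrite eq_le; apply/andP; split; last first.
  apply: le_ereal_sup_tmp; exists (hausdorff_content dist s 1 E).
    by exists 1 => //=; exact: ltr01.
  by apply: le_ereal_inf_tmp => _ [F _ <-]; apply: nneseries_ge0 => i _ _;
    exact: diam_pow_ge0.
apply: ge_ereal_sup => _ [delta /= delta0 <-].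
apply/lee_addgt0Pr => e e0; rewrite add0e.
have [I [P [V [r [EV rd Vr re]]]]] := cov _ _ delta0 e0.
pose F := nth set0 [seq V i | i <- enum P].
have FP k : (k < size (enum P))%N ->
    exists i, [/\ P i, F k = V i & forall i0, i = nth i0 (enum P) k].
  case E0 : (enum P) => [//|i0 l] kl; exists (nth i0 (enum P) k).
  have kl' : (k < size (enum P))%N by rewrite E0.
  split.
  - by have := mem_nth i0 kl'; rewrite mem_enum.
  - by rewrite /F (nth_map i0).
  - by move=> i1; rewrite -E0; apply: set_nth_default.
have F0 k : (size (enum P) <= k)%N -> F k = set0.
  by move=> kl; rewrite /F nth_default // size_map.
apply: (@le_trans _ _ (\sum_(0 <= i <oo) diam_pow dist s (F i))%E).
  apply: ereal_inf_lbound; exists F => //; split=> [x /EV [i Pi Vx]|k].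
    exists (index i (enum P)) => //.
    by rewrite /F (nth_map i) ?index_mem ?mem_enum // nth_index ?mem_enum.
  apply/ediam_leP; case: (ltnP k (size (enum P))) => [/FP [i [Pi -> _]]|/F0 ->//].
  move=> x y /(Vr i x y Pi) h /h /le_trans; apply.
  by case/andP: (rd _ Pi).
rewrite (nneseries_split 0 (size (enum P))) => [|k _]; last exact: diam_pow_ge0.
rewrite add0n [X in (_ + X)%E]eseries0 ?adde0; last first.
  by move=> k /F0 -> _; rewrite /diam_pow eqxx.
apply: (@le_trans _ _ (\sum_(i | P i) r i `^ s)%:E); last by rewrite lee_fin.
rewrite -sumEFin (_ : (\sum_(i | _) _)%E = (\sum_(i <- enum P) (r i `^ s)%:E)%E);
  last by rewrite big_enum.
case E0 : (enum P) => [|i0 l]; first by rewrite big_geq ?big_nil.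
rewrite -E0 (big_nth i0) [leLHS]big_nat [leRHS]big_nat.
apply: lee_sum => k /andP[_ kl].
have [i [Pi -> /(_ i0) <-]] := FP k kl.
by apply: diam_pow_le => // [|x y]; [case/andP: (rd _ Pi)|exact: Vr].
Qed.

Lemma euclid_dist_xx {R : realType} (p : R * R) : euclid_dist p p = 0.
Proof. by rewrite /euclid_dist !subrr expr0n addr0 sqrtr0. Qed.

Lemma coord_le_euclid_dist {R : realType} (p q : R * R) :
  `|p.1 - q.1| <= euclid_dist p q /\ `|p.2 - q.2| <= euclid_dist p q.
Proof.
rewrite /euclid_dist -!sqrtr_sqr; split; apply: ler_wsqrtr.
  by rewrite lerDl sqr_ge0.
by rewrite lerDr sqr_ge0.
Qed.

Lemma sum_half_le1 {R : realType} (N : nat) :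
  \sum_(i < N) (2^-1 : R) ^+ i.+1 <= 1.
Proof.
suff -> : \sum_(i < N) (2^-1 : R) ^+ i.+1 = 1 - 2^-1 ^+ N.
  by rewrite gerBl exprn_ge0.
elim: N => [|N IH]; first by rewrite big_ord0 expr0 subrr.
by rewrite big_ord_recr /= IH exprS; field.
Qed.

(** On ]0, 1] powers decrease as the exponent grows. A zero diameter is treated apart: there [0 < t]
    makes the left side 0. *)
Lemma diam_pow_ge {R : realType} {T : Type} (dist : T -> T -> R) (s t : R)
    (E : set T) :
  (forall x, dist x x = 0) -> 0 < t -> s < t -> (ediam dist E <= 1)%E -> E !=set0 ->
  ((fine (ediam dist E) `^ t)%:E <= diam_pow dist s E)%E.
Proof.
move=> dist0 t0 st E1 E0; have d0 := ediam_ge0 _ _ dist0 E0.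
rewrite /diam_pow ifF; last by apply/negbTE/set0P.
move: d0 E1; case: (ediam dist E) => [x| |] //; rewrite !lee_fin.
rewrite le_eqVlt => /predU1P[<-|x0] x1 /=.
  by rewrite powR0 ?gt_eqF // powR_ge0.
by apply: ger_powR; rewrite ?x0 // ltW.
Qed.

(* A cover by arbitrary sets is fattened to an open one, which increases the
   sum of the t-th powers of the diameters by as little as wanted (up to a
   constant factor); compactness then leaves a finite cover. *)
Lemma hausdorff_measure_neq0 {R : realType} (K : set (R * R)) (s t c : R) :
  compact K -> 0 <= s -> s < t -> 0 < c ->
  (forall (N : nat) (V : nat -> set (R * R)) (r : nat -> R),
    (forall i, 0 < r i <= 1) ->
    (forall i p q, V i p -> V i q ->
      `|p.1 - q.1| <= r i /\ `|p.2 - q.2| <= r i) ->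
    K `<=` \bigcup_(i in `I_N) V i -> c <= \sum_(i < N) r i `^ t) ->
  hausdorff_measure euclid_dist s K <> 0%E.
Proof.
move=> cK s0 st c0 Kc H0.
have t0 : 0 < t by exact: le_lt_trans st.
(* The fattened sets have size d + 2 eta <= 3 max(d, eta), whence the factor 3^t. The choice of [e]
   makes the final bound C (e + e) equal to c / 2. *)
pose C : R := 3 `^ t; have C0 : 0 < C by exact: powR_gt0.
pose e := c / (C * 4); have e0 : 0 < e by rewrite divr_gt0 ?mulr_gt0.
(* At scale 1/4, with fattening by at most 1/4, the sizes d + 2 eta stay below 1. *)
have : (hausdorff_content euclid_dist s 4^-1 K < e%:E)%E.
  apply: (@le_lt_trans _ _ 0%E); last by rewrite lte_fin.
  rewrite -H0; apply: ereal_sup_ubound; exists 4^-1 => //.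
  by rewrite /mkset invr_gt0 ltr0n.
move=> /ereal_inf_lt [_ [F [KF F4] <-] Fe].
pose d i := if F i == set0 then 0 else fine (ediam euclid_dist (F i)).
(* The fattening is positive even around a single point, and its t-th powers add up to at most e. *)
pose eta i := Num.min 4^-1 ((e * 2^-1 ^+ i.+1) `^ t^-1).
have eta0 i : 0 < eta i.
  by rewrite lt_min invr_gt0 ltr0n /= powR_gt0 // mulr_gt0 // exprn_gt0.
have etat i : eta i `^ t <= e * 2^-1 ^+ i.+1.
  have x0 : 0 <= e * 2^-1 ^+ i.+1 by rewrite mulr_ge0 ?exprn_ge0 // ltW.
  rewrite -[leRHS](@powRr1 R) // -[X in _ <= _ `^ X](mulVf (lt0r_neq0 t0)) powRrM.
  apply: ge0_ler_powR; rewrite ?nnegrE ?powR_ge0 //; [exact: ltW|exact: ltW|].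
  by rewrite /eta ge_min lexx orbT.
have dF i p q : F i p -> F i q -> euclid_dist p q <= d i.
  move=> Fp Fq; have Fi0 : F i !=set0 by exists p.
  rewrite /d ifF; last by apply/negbTE/set0P.
  have E0 := ediam_ge0 _ _ euclid_dist_xx Fi0.
  apply: (proj1 (ediam_leP euclid_dist (F i) _)) Fp Fq; rewrite fineK //.
  by rewrite ge0_fin_numE // (le_lt_trans (F4 i)) ?ltry.
have d4 k : 0 <= d k <= 4^-1.
  rewrite /d; case: eqP => [_|/eqP/set0P Fi0]; first by rewrite lexx invr_ge0 /=.
  have E0 := ediam_ge0 _ _ euclid_dist_xx Fi0.
  rewrite fine_ge0 //= -(lee_fin _ 4^-1) fineK // ge0_fin_numE //.
  by rewrite (le_lt_trans (F4 k)) ?ltry.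
have dt i : ((d i `^ t)%:E <= diam_pow euclid_dist s (F i))%E.
  rewrite /d; case: eqP => [->|/eqP/set0P Fi0].
    by rewrite powR0 ?gt_eqF // diam_pow_ge0.
  apply: diam_pow_ge Fi0 => //; first exact: euclid_dist_xx.
  apply: le_trans (F4 i) _; rewrite lee_fin invf_le1 ?ler1n //.
pose V i := [set p : R * R | exists2 q, F i q & `|q.1 - p.1| < eta i /\ `|q.2 - p.2| < eta i].
have oV i : open (V i).
  rewrite (_ : V i = \bigcup_(q in F i) ball q (eta i)).
    by apply: bigcup_open => q _; apply: ball_open.
  apply/seteqP; split=> [p [q Fq [h1 h2]]|p [q Fq [h1 h2]]].
    by exists q => //; split; rewrite -ball_normE.
  by exists q => //; move: h1 h2; rewrite -!ball_normE.
have KV p : K p -> exists i, V i p.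
  by move=> /KF [i _ Fp]; exists i, p => //; rewrite !subrr normr0.
have [N KN] : exists N, K `<=` \bigcup_(i in `I_N) V i.
  have /compact_near_coveringP/(_ nat \oo (fun N => \bigcup_(i in `I_N) V i) _) := cK.
  case=> [p /KV [i Vp]|N _ KN]; last by exists N; apply: (KN N) => /=.
  exists (V i, [set N | (i < N)%N]) => /=.
    by split; [exact: open_nbhs_nbhs|exists i.+1].
  by move=> [q N] /= [Vq iN]; exists i.
pose r i := d i + 2 * eta i.
have rt i : r i `^ t <= C * (d i `^ t + e * 2^-1 ^+ i.+1).
  have [d0 _] := andP (d4 i).
  have h x : 0 <= x -> r i <= 3 * x -> r i `^ t <= C * x `^ t.
    move=> x0 rx; rewrite -powRM //; apply: ge0_ler_powR => //; rewrite ?nnegrE.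
    - exact: ltW.
    - by rewrite addr_ge0 // mulr_ge0 // ltW.
    - by rewrite mulr_ge0.
  have [de|ed] := leP (d i) (eta i).
    apply: (le_trans (h (eta i) (ltW (eta0 i)) _)); first by rewrite /r; lra.
    rewrite ler_pM2l //; apply: le_trans (etat i) _.
    by rewrite lerDr powR_ge0.
  apply: (le_trans (h (d i) d0 _)); first by rewrite /r; lra.
  by rewrite ler_pM2l // lerDl mulr_ge0 ?exprn_ge0 // ltW.
have : c <= \sum_(i < N) r i `^ t.
  apply: (Kc N V r) => [i|i p q [p' Fp [p1 p2]] [q' Fq [q1 q2]]|//].
  - have := d4 i; have := eta0 i; have : eta i <= 4^-1 by rewrite /eta ge_min lexx.
    rewrite /r; lra.
  - have /dF /(_ Fq) := Fp; have [] := coord_le_euclid_dist p' q'.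
    move: p1 p2 q1 q2; rewrite /r !ltr_norml !ler_norml; lra.
apply/negP; rewrite -ltNge.
apply: (@le_lt_trans _ _ (C * (e + e))); last first.
  rewrite /e (_ : C * _ = c * 2^-1); last by field; rewrite gt_eqF.
  lra.
apply: (@le_trans _ _ (\sum_(i < N) C * (d i `^ t + e * 2^-1 ^+ i.+1))).
  by apply: ler_sum => i _; exact: rt.
rewrite -mulr_sumr ler_pM2l // big_split /= lerD //; last first.
  by rewrite -mulr_sumr -[leRHS]mulr1 ler_pM2l // sum_half_le1.
rewrite -lee_fin -sumEFin; apply/ltW; apply: le_lt_trans Fe.
apply: le_trans (nneseries_lim_ge N _); last by move=> *; exact: diam_pow_ge0.
by rewrite big_mkord; apply: lee_sum => i _.
Qed.

(** * Words in systems of similarities *)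

Section Words.
Context {R : realType} {I : eqType} (f : I -> R -> R) (r : R).
Hypothesis r0 : 0 < r.
Hypothesis fsim : forall i, is_similarity r (f i).
Hypothesis fsurj : forall i y, exists x, f i x = y.

Lemma foldr_similarity (w : seq I) :
  is_similarity (r ^+ size w) (fun x => foldr f x w).
Proof.
elim: w => [|i w IH] x y /=; first by rewrite expr0 mul1r.
by rewrite fsim IH exprS mulrA.
Qed.

Lemma foldr_surj (w : seq I) y : exists x, foldr f x w = y.
Proof.
elim: w y => [|i w IH] y /=; first by exists y.
by have [z <-] := fsurj i y; have [x <-] := IH z; exists x.
Qed.

(* [e] relates the letters that have to be told apart: the horizontal maps are
   only separated within a fibre of the factor map. *)
Definition separated_on (e : rel I) (U : set R) : Prop :=
  (forall i x, U x -> U (f i x)) /\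
  (forall i j x y, e i j -> i != j -> U x -> U y -> f i x <> f j y).

(** Equal first letters cancel because a similarity of positive ratio is injective; at the first
    differing letters the images of U are disjoint. *)
Lemma foldr_separated (e : rel I) (U : set R) (v w : seq I) x y :
  separated_on e U -> size v = size w -> all2 e v w -> v != w ->
  U x -> U y -> foldr f x v <> foldr f y w.
Proof.
move=> [fU sepU].
have foldU u z : U z -> U (foldr f z u) by elim: u => //= i u IH /IH /fU.
elim: v w => [|i v IH] [|j w] //= [vw] /andP[eij evw] nvw Ux Uy.
have [ij|/sepU] := eqVneq i j; last by apply => //; exact: foldU.
rewrite ij eqseq_cons eqxx /= in nvw *.
move=> fE; apply: (IH w vw evw nvw Ux Uy).
have /eqP : r * `|foldr f x v - foldr f y w| = 0.
  by rewrite -(fsim j) fE subrr normr0.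
by rewrite mulf_eq0 gt_eqF //= normr_eq0 subr_eq0 => /eqP.
Qed.

(** The words send the centre c to points that lie within r^k (1 + B) of a and are pairwise at least
    r^k eps apart. An interval holds boundedly many such points, with a bound free of k. *)
Lemma separated_words_count (e : rel I) (U : set R) (c eps B a : R) (k : nat)
    (s : seq (seq I)) :
  separated_on e U -> 0 < eps -> (forall x, `|x - c| < eps -> U x) ->
  uniq s -> (forall v, v \in s -> size v = k) ->
  (forall v w, v \in s -> w \in s -> all2 e v w) ->
  (forall v, v \in s ->
    exists2 x, `|x - c| <= B & `|foldr f x v - a| <= r ^+ k) ->
  (size s <= (Num.truncn (2 * (1 + B) / eps)).+1)%N.
Proof.
move=> sepU eps0 Ueps us sk es sB.
have rk0 : 0 < r ^+ k by rewrite exprn_gt0.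
pose z v := foldr f c v.
(* Rescaled so that the points lie in [0, 2 (1 + B) / eps] at mutual distance at least 1: their
   integer parts are then distinct. *)
pose h v := (z v - a + r ^+ k * (1 + B)) / (r ^+ k * eps).
have zB v : v \in s -> `|z v - a| <= r ^+ k * (1 + B).
  move=> vs; have [x xB xa] := sB v vs.
  have : `|z v - foldr f x v| <= r ^+ k * B.
    by rewrite (foldr_similarity v) (sk v vs) ler_pM2l // distrC.
  rewrite mulrDr mulr1; move: xa; rewrite !ler_norml; lra.
(* Were the points closer, the preimage of z v under the word w would lie within eps of c, hence in
   U, and two separated words would share an image point. *)
have zsep v w : v \in s -> w \in s -> v != w -> r ^+ k * eps <= `|z v - z w|.
  move=> vs ws nvw; rewrite leNgt; apply/negP => zvw.
  have [x xE] := foldr_surj w (z v).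
  apply: (@foldr_separated e U v w c x sepU _ (es _ _ vs ws) nvw).
  - by rewrite !sk.
  - by apply: Ueps; rewrite subrr normr0.
  - apply: Ueps; rewrite -(ltr_pM2l rk0); apply: le_lt_trans zvw.
    by rewrite -xE -(sk w ws) -(foldr_similarity w).
  - by rewrite xE.
have h0 v : v \in s -> 0 <= h v <= 2 * (1 + B) / eps.
  move=> /zB; rewrite ler_norml => /andP[z1 z2].
  rewrite divr_ge0 ?mulr_ge0 ?(ltW rk0) ?(ltW eps0) //=; last lra.
  rewrite /h ler_pdivrMr ?mulr_gt0 //.
  rewrite (_ : _ * (r ^+ k * eps) = 2 * (r ^+ k * (1 + B))); last first.
    by field; rewrite gt_eqF.
  lra.
rewrite -(size_map (Num.truncn \o h)) -[leqRHS](size_iota 0).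
apply: uniq_leq_size.
  rewrite map_inj_in_uniq // => v w vs ws /= hvw.
  apply/eqP; apply/negPn/negP => nvw; have := zsep v w vs ws nvw.
  apply/negP; rewrite -ltNge.
  have /andP[hv0 _] := h0 v vs; have /andP[hw0 _] := h0 w ws.
  have /andP[] := truncn_itv hv0; have /andP[] := truncn_itv hw0.
  rewrite hvw; set t := Num.truncn _ => w1 w2 v1 v2.
  rewrite (_ : z v - z w = (h v - h w) * (r ^+ k * eps)); last first.
    by rewrite /h; field; rewrite ?gt_eqF.
  rewrite normrM (gtr0_norm (mulr_gt0 rk0 eps0)) -[ltRHS]mul1r.
  rewrite ltr_pM2r ?mulr_gt0 // ltr_norml.
  move: w1 w2 v1 v2; rewrite -natr1; lra.
move=> _ /mapP[v vs ->]; rewrite mem_iota add0n ltnS.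
have /andP[hv0 hvB] := h0 v vs.
exact: le_truncn.
Qed.

End Words.

(** * Averages over words with independent letters *)

Section WordMean.
Context {R : realType} {T : finType} (p : T -> R).

(** For weights [p] of total 1 this is the expectation of F over words of k independent letters of
    law [p], by conditioning on the first letter. *)
Fixpoint word_mean (k : nat) (F : seq T -> R) : R :=
  if k is k'.+1 then \sum_d p d * word_mean k' (fun w => F (d :: w))
  else F [::].

Lemma word_mean_sum (J : Type) (s : seq J) (F : J -> seq T -> R) (k : nat) :
  word_mean k (fun w => \sum_(h <- s) F h w) =
  \sum_(h <- s) word_mean k (F h).
Proof.
elim: k F => [|k IH] F //=; rewrite exchange_big /=; apply: eq_bigr => d _.
by rewrite IH mulr_sumr.
Qed.

Lemma word_mean_Zl (a : R) (F : seq T -> R) (k : nat) :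
  word_mean k (fun w => a * F w) = a * word_mean k F.
Proof.
elim: k F => [|k IH] F //=; rewrite mulr_sumr; apply: eq_bigr => d _.
by rewrite IH mulrCA.
Qed.

Lemma word_mean_cst (a : R) (k : nat) :
  \sum_d p d = 1 -> word_mean k (fun=> a) = a.
Proof.
by move=> p1; elim: k => //= k ->; rewrite -mulr_suml p1 mul1r.
Qed.

Hypothesis p0 : forall d, 0 <= p d.

Lemma le_word_mean (F G : seq T -> R) (k : nat) :
  (forall w, size w = k -> F w <= G w) -> word_mean k F <= word_mean k G.
Proof.
elim: k F G => [|k IH] F G FG /=; first exact: FG.
apply: ler_sum => d _; apply: ler_wpM2l => //; apply: IH => w wk.
by apply: FG; rewrite /= wk.
Qed.

Context {A : finType} (theta : T -> A) (pm qm : R).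
Hypothesis p1 : \sum_d p d = 1.
Hypothesis p_le : forall d, p d <= pm.
Hypothesis q_le : forall a, \sum_(d | theta d == a) p d <= qm.

(* Names the approximate square of width [rx ^+ l] and height [ry ^+ (l + j)]
   containing the points coded by [w]. *)
Definition approx_square (l j : nat) (w : seq T) : seq T * seq A :=
  (take l w, map theta (take j (drop l w))).

Lemma word_mean_weak_cylinder (b : seq A) (j k : nat) : 0 <= qm -> (j <= k)%N ->
  word_mean k (fun w => (map theta (take j w) == b)%:R) <= qm ^+ j.
Proof.
move=> qm0; elim: j b k => [|j IH] b k jk.
  rewrite expr0 -[leRHS](word_mean_cst 1 k p1); apply: le_word_mean => w _.
  by rewrite lern1 leq_b1.
case: k jk => // k jk; case: b => [|a b] /=.
  rewrite big1 ?exprn_ge0 // => d _.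
  by rewrite (word_mean_cst 0 k p1) mulr0.
apply: (@le_trans _ _ (\sum_(d | theta d == a) p d * qm ^+ j)).
  rewrite [leRHS]big_mkcond /=; apply: ler_sum => d _.
  rewrite (_ : (fun w => _) = (fun w => (theta d == a)%:R *
    (map theta (take j w) == b)%:R :> R)); last first.
    by apply/funext => w; rewrite eqseq_cons -natrM mulnb.
  rewrite word_mean_Zl; case: eqP => _; last by rewrite mul0r mulr0.
  by rewrite mul1r ler_wpM2l // IH.
by rewrite -mulr_suml exprS ler_wpM2r // exprn_ge0.
Qed.

(** By independence, each of the l prescribed digits costs a factor at most [pm], each of the j
    prescribed weak letters a factor at most [qm]. *)
Lemma word_mean_approx_square (h : seq T * seq A) (l j k : nat) :
  0 <= pm -> 0 <= qm -> (l + j <= k)%N ->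
  word_mean k (fun w => (approx_square l j w == h)%:R) <= pm ^+ l * qm ^+ j.
Proof.
move=> pm0 qm0; elim: l h k => [|l IH] h k ljk.
  rewrite expr0 mul1r; apply: le_trans (word_mean_weak_cylinder h.2 _ _ qm0 ljk).
  apply: le_word_mean => w _; rewrite ler_nat.
  by rewrite /approx_square drop0; case: h => h1 h2 /=; rewrite xpair_eqE; case: eqP; rewrite ?leq_b1.
case: k ljk => // k ljk; case: h => -[|d0 v] b /=.
  rewrite big1 ?mulr_ge0 ?exprn_ge0 // => d _.
  by rewrite (word_mean_cst 0 k p1) mulr0.
apply: (@le_trans _ _ (\sum_(d | d == d0) p d * (pm ^+ l * qm ^+ j))).
  rewrite [leRHS]big_mkcond /=; apply: ler_sum => d _.
  rewrite (_ : (fun w => _) = (fun w => (d == d0)%:R *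
    (approx_square l j w == (v, b))%:R :> R)); last first.
    by apply/funext => w; rewrite -natrM mulnb !xpair_eqE eqseq_cons andbA.
  rewrite word_mean_Zl; case: eqP => _; last by rewrite mul0r mulr0.
  by rewrite mul1r ler_wpM2l // IH.
by rewrite big_pred1_eq exprS -mulrA ler_wpM2r // mulr_ge0 ?exprn_ge0.
Qed.

End WordMean.

Section WordsOfLength.
Variable T : finType.

Definition words (k : nat) : seq (seq T) := map val (enum {: k.-tuple T}).

Lemma mem_words k w : (w \in words k) = (size w == k).
Proof.
apply/mapP/eqP => [[u _ ->]|wk]; first exact: size_tuple.
by subst k; exists (in_tuple w); rewrite ?mem_enum.
Qed.

End WordsOfLength.

(** * Mass distribution *)

Lemma exprn_lt_eventually {R : realType} (r delta : R) : 0 < r -> r < 1 ->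
  0 < delta -> exists N, forall n, (N <= n)%N -> r ^+ n < delta.
Proof.
move=> r0 r1 delta0.
have /cvgrPdist_lt/(_ _ delta0)[N _ NP] : (@GRing.exp R r) @ \oo --> 0.
  by apply: cvg_expr; rewrite ger0_norm // ltW.
by exists N => n /NP; rewrite sub0r normrN ger0_norm // exprn_ge0 // ltW.
Qed.

Lemma scale_index {R : realType} (r delta : R) : 0 < r -> r < 1 ->
  0 < delta <= 1 -> exists2 l, r ^+ l.+1 < delta & delta <= r ^+ l.
Proof.
move=> r0 r1 /andP[delta0 delta1].
have [n rn] : exists n, r ^+ n < delta.
  by have [n nP] := exprn_lt_eventually _ _ r0 r1 delta0; exists n; exact: nP.
have := ex_intro (fun n => r ^+ n < delta) n rn => exn.
case: (ex_minnP exn) => -[|l]; first by rewrite expr0 ltNge delta1.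
move=> rl lmin; exists l => //; rewrite leNgt; apply/negP => /lmin.
by rewrite ltnn.
Qed.

(* Only [separated_on] is asked of the open sets [Ux] and [Uy], together with a
   ball that each of them contains; both properties pass to the system of the
   words of a given length, with the same sets and balls. *)
Set Implicit Arguments.
Record separated_carpet {R : realType} {T A : finType} (theta : T -> A)
    (f : T -> R -> R) (g : A -> R -> R) (rx ry : R) (Ux Uy : set R)
    (cx cy ex ey : R) (K : set (R * R)) (B : R) : Prop := SeparatedCarpet {
  sc_rx0 : 0 < rx;
  sc_rxy : rx < ry;
  sc_ry1 : ry < 1;
  sc_fsim : forall d, is_similarity rx (f d);
  sc_gsim : forall a, is_similarity ry (g a);
  sc_fsurj : forall d y, exists x, f d x = y;
  sc_gsurj : forall a y, exists x, g a x = y;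
  sc_fsep : separated_on f (fun d d' => theta d == theta d') Ux;
  sc_gsep : separated_on g (fun _ _ => true) Uy;
  sc_ex0 : 0 < ex;
  sc_ey0 : 0 < ey;
  sc_Uex : forall x, `|x - cx| < ex -> Ux x;
  sc_Uey : forall y, `|y - cy| < ey -> Uy y;
  sc_Kinv : forall d p, K p -> K (f d p.1, g (theta d) p.2);
  sc_KB : forall p, K p -> `|p.1 - cx| <= B /\ `|p.2 - cy| <= B
}.
Unset Implicit Arguments.

Section SelfAffine.
Context {R : realType} {T A : finType} (theta : T -> A).
Context (f : T -> R -> R) (g : A -> R -> R) (rx ry : R).
Context (Ux Uy : set R) (cx cy ex ey : R) (K : set (R * R)) (B : R).
Hypothesis H : separated_carpet theta f g rx ry Ux Uy cx cy ex ey K B.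
Context (p0 : R * R).
Hypothesis Kp0 : K p0.

Let rx0 := sc_rx0 H.
Let rxy := sc_rxy H.
Let ry1 := sc_ry1 H.
Let ry0 : 0 < ry := lt_trans rx0 rxy.

Definition word_point (w : seq T) : R * R :=
  (foldr f p0.1 w, foldr g p0.2 (map theta w)).

Lemma word_point_in w : K (word_point w).
Proof. by elim: w => [|d w /(sc_Kinv H d)//]; rewrite /word_point -surjective_pairing. Qed.

(** The two bounds of [separated_words_count], horizontal and vertical; neither depends on the
    scale. *)
Definition strong_bound : nat := (Num.truncn (2 * (1 + B) / ex)).+1.
Definition weak_bound : nat := (Num.truncn (2 * (1 + B) / ey)).+1.

(** Vertical separation bounds the number of weak words of length l + j that meet V. Once such a
    word is fixed, the digit prefixes of length l have the same image under theta, so horizontal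
    separation within fibres bounds their number. *)
Lemma approx_squares_hit_count (V : set (R * R)) (l j k : nat)
    (s := [seq approx_square theta l j w
          | w <- words T k & `[< V (word_point w) >]]) :
  (l + j <= k)%N ->
  (forall p q, V p -> V q ->
    `|p.1 - q.1| <= rx ^+ l /\ `|p.2 - q.2| <= ry ^+ (l + j)) ->
  (size (undup s) <= weak_bound * strong_bound)%N.
Proof.
move=> ljk Vdiam.
pose hits := [seq w <- words T k | `[< V (word_point w) >]].
have hitsP w : w \in hits -> size w = k /\ V (word_point w).
  by rewrite mem_filter mem_words => /andP[/asboolP Vw /eqP].
pose b w := map theta (take (l + j) w).
pose Y := undup (map b hits).
pose X u := undup [seq take l w | w <- hits & b w == u].
pose s' := flatten [seq [seq (v, drop l u) | v <- X u] | u <- Y].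
have ss' : {subset undup s <= s'}.
  move=> h; rewrite mem_undup => /mapP[w wh ->].
  apply/flatten_mapP; exists (b w); first by rewrite mem_undup map_f.
  apply/mapP; exists (take l w).
    by rewrite mem_undup; apply: map_f; rewrite mem_filter eqxx.
  rewrite /approx_square /b -map_drop; congr (_, map _ _).
  by rewrite addnC take_drop.
apply: (leq_trans (uniq_leq_size (undup_uniq s) ss')).
have Xle u : (size (X u) <= strong_bound)%N.
  case hitsE : hits => [|w0 s0]; first by rewrite /X hitsE.
  have w0h : w0 \in hits by rewrite hitsE mem_head.
  have [w0k Vw0] := hitsP _ w0h.
  apply: (@separated_words_count R T f rx rx0 (sc_fsim H) (sc_fsurj H) _ Ux cx ex B
    (word_point w0).1 l _ (sc_fsep H) (sc_ex0 H) (sc_Uex H) (undup_uniq _)).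
  - move=> v; rewrite mem_undup => /mapP[w]; rewrite mem_filter => /andP[_].
    by move=> /hitsP[wk _] ->; rewrite size_takel // wk (leq_trans (leq_addr j l)).
  - move=> v v'; rewrite !mem_undup => /mapP[w]; rewrite mem_filter => /andP[/eqP bu].
    move=> /hitsP[wk _] -> /mapP[w']; rewrite mem_filter => /andP[/eqP bu'].
    move=> /hitsP[wk' _] ->.
    have : map theta (take l w) = map theta (take l w').
      rewrite !map_take; have := congr1 (take l) (etrans bu (esym bu')).
      by rewrite /b -!map_take !take_takel ?leq_addr.
    elim: (take l w) (take l w') => [|d t IH] [|d' t'] //= [-> /IH ->].
    by rewrite eqxx.
  - move=> v; rewrite mem_undup => /mapP[w]; rewrite mem_filter => /andP[_].
    move=> /hitsP[wk Vw] ->; exists (word_point (drop l w)).1.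
      by have [] := sc_KB H _ (word_point_in (drop l w)).
    by rewrite -foldr_cat cat_take_drop; have [] := Vdiam _ _ Vw Vw0.
have Yle : (size Y <= weak_bound)%N.
  case hitsE : hits => [|w0 s0]; first by rewrite /Y hitsE.
  have w0h : w0 \in hits by rewrite hitsE mem_head.
  have [w0k Vw0] := hitsP _ w0h.
  apply: (@separated_words_count R A g ry ry0 (sc_gsim H) (sc_gsurj H) _ Uy cy ey B
    (word_point w0).2 (l + j) _ (sc_gsep H) (sc_ey0 H) (sc_Uey H) (undup_uniq _)).
  - move=> v; rewrite mem_undup => /mapP[w /hitsP[wk _]] ->.
    by rewrite size_map size_takel // wk.
  - move=> v v'; rewrite !mem_undup => /mapP[w /hitsP[wk _]] -> /mapP[w' /hitsP[wk' _]] ->.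
    have : size (b w) = size (b w') by rewrite !size_map !size_takel ?wk ?wk'.
    by elim: (b w) (b w') => [|? ? IH] [|? ?] //= [/IH].
  - move=> v; rewrite mem_undup => /mapP[w /hitsP[wk Vw]] ->.
    exists (word_point (drop (l + j) w)).2.
      by have [] := sc_KB H _ (word_point_in (drop (l + j) w)).
    by rewrite -foldr_cat -map_cat cat_take_drop; have [] := Vdiam _ _ Vw Vw0.
rewrite /s' size_flatten /shape -map_comp sumnE big_map.
apply: (@leq_trans (\sum_(u <- Y) strong_bound)).
  by apply: leq_sum => u _; rewrite /= size_map.
by rewrite big_const_seq count_predT iter_addn_0 mulnC leq_mul2r Yle orbT.
Qed.

Context (p : T -> R) (pm qm : R).
Hypothesis p_ge0 : forall d, 0 <= p d.
Hypothesis p1 : \sum_d p d = 1.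
Hypothesis p_le : forall d, p d <= pm.
Hypothesis q_le : forall a, \sum_(d | theta d == a) p d <= qm.
Hypothesis pm0 : 0 <= pm.
Hypothesis qm0 : 0 <= qm.

(** Union bound: the indicator of hitting V is at most the sum of the indicators of the boundedly
    many approximate squares that are hit. *)
Lemma word_mean_hit (V : set (R * R)) (l j k : nat) :
  (l + j <= k)%N ->
  (forall p q, V p -> V q ->
    `|p.1 - q.1| <= rx ^+ l /\ `|p.2 - q.2| <= ry ^+ (l + j)) ->
  word_mean p k (fun w => (`[< V (word_point w) >])%:R) <=
    (weak_bound * strong_bound)%:R * (pm ^+ l * qm ^+ j).
Proof.
move=> ljk Vdiam.
have := approx_squares_hit_count V l j k ljk Vdiam.
set s := undup _ => ss.
apply: (@le_trans _ _ (word_mean p k (fun w =>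
    \sum_(h <- s) (approx_square theta l j w == h)%:R))).
  apply: le_word_mean => // w wk.
  case: asboolP => Vw; last by apply: sumr_ge0 => h _.
  rewrite (bigD1_seq (approx_square theta l j w)) ?undup_uniq //=.
    by rewrite eqxx lerDl; apply: sumr_ge0 => h _.
  rewrite mem_undup; apply: map_f.
  by rewrite mem_filter mem_words wk eqxx andbT; apply/asboolP.
rewrite word_mean_sum.
apply: (@le_trans _ _ (\sum_(h <- s) (pm ^+ l * qm ^+ j))).
  by apply: ler_sum => h _; exact: word_mean_approx_square.
rewrite big_const_seq count_predT iter_addr_0 -[leLHS]mulr_natl.
by rewrite ler_wpM2r ?mulr_ge0 ?exprn_ge0 // ler_nat.
Qed.

Context (t1 t2 : R).
Hypothesis t10 : 0 <= t1.
Hypothesis t20 : 0 <= t2.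
Hypothesis pmE : pm = rx `^ t1 * ry `^ t2.
Hypothesis qmE : qm = ry `^ t2.

(** The inverse powers absorb one step of the scales, since delta lies between consecutive powers of
    [rx] and of [ry]. *)
Definition mass_const : R :=
  (weak_bound * strong_bound)%:R * ((rx `^ t1)^-1 * (ry `^ t2)^-1).

Lemma mass_const_gt0 : 0 < mass_const.
Proof.
by rewrite /mass_const mulr_gt0 ?ltr0n ?muln_gt0 // mulr_gt0 // invr_gt0 powR_gt0.
Qed.

(** With rx^l and ry^q both close to delta, the form of [pm] and [qm] turns pm^l qm^(q-l) into
    (rx^l)^t1 (ry^q)^t2, which is comparable to delta^(t1 + t2). *)
Lemma word_mean_le_powR (V : set (R * R)) (delta : R) : 0 < delta <= 1 ->
  (forall p q, V p -> V q ->
    `|p.1 - q.1| <= delta /\ `|p.2 - q.2| <= delta) ->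
  exists k0, forall k, (k0 <= k)%N ->
    word_mean p k (fun w => (`[< V (word_point w) >])%:R) <=
      mass_const * delta `^ (t1 + t2).
Proof.
move=> delta01 Vdiam; have [delta0 _] := andP delta01.
have rx1 : rx < 1 by exact: lt_trans rxy _.
have [l rl lr] := scale_index _ _ rx0 rx1 delta01.
have [q rq qr] := scale_index _ _ ry0 ry1 delta01.
have lq : (l <= q)%N.
  rewrite leqNgt; apply/negP => ql; have : ry ^+ q.+1 < rx ^+ l by exact: lt_le_trans lr.
  apply/negP; rewrite -leNgt.
  apply: (@le_trans _ _ (rx ^+ q.+1)).
    by apply: ler_wiXn2l => //; exact: ltW.
  by rewrite lerXn2r ?nnegrE ?ltW.
exists q => k qk.
apply: (@le_trans _ _ ((weak_bound * strong_bound)%:R * (pm ^+ l * qm ^+ (q - l)))).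
  apply: word_mean_hit => [|p' q' Vp Vq]; first by rewrite subnKC.
  have [h1 h2] := Vdiam _ _ Vp Vq; rewrite subnKC //.
  by split; [apply: le_trans lr|apply: le_trans qr].
rewrite /mass_const -mulrA ler_wpM2l //.
have powRX x t n : 0 <= x -> (x `^ t) ^+ n = (x ^+ n) `^ t.
  by move=> x0; rewrite -!powR_mulrn ?powR_ge0 // -!powRrM mulrC.
have -> : pm ^+ l * qm ^+ (q - l) = (rx ^+ l) `^ t1 * (ry ^+ q) `^ t2.
  rewrite pmE qmE exprMn -mulrA -exprD subnKC // !powRX // ltW //.
rewrite powRD; last by rewrite (gt_eqF delta0) implybT.
have key x t n : 0 < x -> 0 <= t -> x ^+ n.+1 < delta ->
    (x ^+ n) `^ t <= (x `^ t)^-1 * delta `^ t.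
  move=> x0 t0 xd; rewrite ler_pdivlMl ?powR_gt0 //.
  rewrite -powRM ?exprn_ge0 ?(ltW x0) // -exprS.
  by apply: ge0_ler_powR; rewrite ?nnegrE ?exprn_ge0 // ltW.
rewrite mulrACA; apply: ler_pM; rewrite ?powR_ge0 //; exact: key.
Qed.

(** A cover by finitely many sets admits one word length beyond all their thresholds. Every coded
    point of that length lies in some V i, so the hitting probabilities add up to at least 1. *)
Lemma mass_distribution (N : nat) (V : nat -> set (R * R)) (r : nat -> R) :
  (forall i, 0 < r i <= 1) ->
  (forall i p q, V i p -> V i q ->
    `|p.1 - q.1| <= r i /\ `|p.2 - q.2| <= r i) ->
  K `<=` \bigcup_(i in `I_N) V i ->
  mass_const^-1 <= \sum_(i < N) r i `^ (t1 + t2).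
Proof.
move=> r01 Vdiam KV.
have /choice[k kP] := fun i => word_mean_le_powR (V i) (r i) (r01 i) (Vdiam i).
pose k0 := (\max_(i < N) k i)%N.
rewrite -div1r ler_pdivrMr ?mass_const_gt0 // mulrC mulr_sumr.
rewrite -[leLHS](word_mean_cst p 1 k0 p1).
apply: (@le_trans _ _ (word_mean p k0 (fun w =>
    \sum_(i < N) (`[< V i (word_point w) >])%:R))).
  apply: le_word_mean => // w _.
  have [i /= iN Vi] := KV _ (word_point_in w).
  rewrite (bigD1 (Ordinal iN)) //= asboolT // lerDl.
  by apply: sumr_ge0 => j _.
rewrite word_mean_sum; apply: ler_sum => i _; apply: kP.
exact: leq_bigmax.
Qed.

End SelfAffine.

(** * Lower bound *)

Lemma sum_tuple_prod {R : comRingType} {T : finType} (L : nat)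
    (F : 'I_L -> T -> R) :
  \sum_(u : L.-tuple T) \prod_(i < L) F i (tnth u i) =
  \prod_(i < L) \sum_d F i d.
Proof.
rewrite bigA_distr_bigA /=.
rewrite (reindex (fun h : {ffun 'I_L -> T} => [tuple h i | i < L])) /=; last first.
  apply: onW_bij; exists (fun u : L.-tuple T => [ffun i => tnth u i]) => [h|u].
    by apply/ffunP => i; rewrite ffunE tnth_mktuple.
  by apply: eq_from_tnth => i; rewrite tnth_mktuple ffunE.
by apply: eq_bigr => h _; apply: eq_bigr => i _; rewrite tnth_mktuple.
Qed.

Lemma sum_tuple_prod_cst {R : comRingType} {T : finType} (L : nat) (F : T -> R) :
  \sum_(u : L.-tuple T) \prod_(d <- u) F d = (\sum_d F d) ^+ L.
Proof.
rewrite -[in RHS](card_ord L) -prodr_const -(sum_tuple_prod _ (fun=> F)).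
by apply: eq_bigr => u _; rewrite big_tuple.
Qed.

(** * Fibres of the factor map on words *)

Section Fibres.
Context {T A : finType} (theta : T -> A).

Definition fibre_card (a : A) : nat := #|[pred d | theta d == a]|.

Definition fibre_prod (u : seq A) : nat := (\prod_(a <- u) fibre_card a)%N.

Lemma card_tuple_fibre (L : nat) (u : L.-tuple A) :
  #|[pred v : L.-tuple T | [tuple of map theta v] == u]| = fibre_prod u.
Proof.
(* Moved to a commutative ring, where the indicator of the fibre is a product over positions and
   [sum_tuple_prod] factors the sum. *)
apply/eqP; rewrite -(@eqr_nat int); apply/eqP.
rewrite -sum1_card natr_sum big_mkcond /=.
rewrite /fibre_prod natr_prod big_tuple.
under [RHS]eq_bigr => i _ do rewrite /fibre_card -sum1_card natr_sum big_mkcond /=.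
rewrite -sum_tuple_prod; apply: eq_bigr => v _.
rewrite inE; case: eqP => [<-|nvu].
  by rewrite big1 // => i _; rewrite inE tnth_map eqxx.
have [i vi] : exists i, theta (tnth v i) != tnth u i.
  apply/existsP; rewrite -negb_forall; apply/negP => /forallP vu.
  by apply: nvu; apply: eq_from_tnth => i; rewrite tnth_map; apply/eqP.
by rewrite (bigD1 i) //= inE (negbTE vi) mul0r.
Qed.

End Fibres.

(* Pigeonhole over the numbers of occurrences of the letters: there are
   polynomially many, so one of them carries the exponential growth rate. *)
Lemma uniform_words {R : realType} {A : finType} (N : A -> nat) (b : R) (L : nat) :
  (exists a : A, True) -> (forall a, 0 < N a)%N ->
  exists (W : {set L.-tuple A}) (n : nat),
    [/\ (0 < n)%N, (0 < #|W|)%N,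
        forall u, u \in W -> (\prod_(a <- u) N a)%N = n &
        (\sum_a (N a)%:R `^ b) ^+ L <=
          (L.+1 ^ #|A|)%:R * (#|W|%:R * n%:R `^ b) :> R].
Proof.
move=> [a0 _] N0.
pose type (u : L.-tuple A) := [ffun a => inord (count_mem a u) : 'I_L.+1].
pose x c : R := \sum_(u | type u == c) (\prod_(a <- u) N a)%:R `^ b.
have xE : (\sum_a (N a)%:R `^ b) ^+ L = \sum_c x c.
  rewrite -sum_tuple_prod_cst (partition_big type xpredT) //=.
  apply: eq_bigr => c _; apply: eq_bigr => u _.
  rewrite natr_prod; elim: (val u) => [|a w IH]; first by rewrite !big_nil powR1.
  by rewrite !big_cons IH powRM // prodr_ge0.
have Z0 : 0 < \sum_c x c.
  rewrite -xE exprn_gt0 // (bigD1 a0) //= ltr_wpDr ?powR_gt0 ?ltr0n //.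
  by apply: sumr_ge0 => a _; exact: powR_ge0.
pose c0 : {ffun A -> 'I_L.+1} := [ffun=> ord0].
pose c := [arg max_(c > c0) x c]%O.
have cmax c' : x c' <= x c.
  by rewrite /c; case: arg_maxP => // c1 _; exact.
have xc0 : 0 < x c.
  rewrite ltNge; apply/negP => xc; move: Z0; apply/negP; rewrite -leNgt.
  by apply: sumr_le0 => c' _; exact: le_trans (cmax c') xc.
pose W := [set u | type u == c]%SET.
have /set0Pn[u0 u0W] : W != finset.set0.
  apply/eqP => W0; move: xc0; rewrite /x big_pred0 ?ltxx // => u.
  by have := finset.in_set0 u; rewrite -W0 inE.
(* Words with equal letter counts are permutations of each other. *)
have WE u : u \in W -> (\prod_(a <- u) N a)%N = (\prod_(a <- u0) N a)%N.
  rewrite inE in u0W; rewrite inE => /eqP uc; apply: perm_big.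
  apply/allP => a _ /=; move: uc; rewrite -(eqP u0W) => /ffunP/(_ a).
  have count_lt (w : L.-tuple A) : (count_mem a w < L.+1)%N.
    by rewrite ltnS -[leqRHS](size_tuple w) count_size.
  by rewrite !ffunE => /(congr1 val); rewrite /= !inordK // => ->.
exists W, (\prod_(a <- u0) N a)%N; split=> //.
- by elim: (val u0) => [|a w IH]; rewrite ?big_nil ?big_cons // muln_gt0 N0.
- by apply/card_gt0P; exists u0.
rewrite xE; apply: (@le_trans _ _ (\sum_(c' : {ffun A -> 'I_L.+1}) x c)).
  by apply: ler_sum => c' _; exact: cmax.
rewrite sumr_const card_ffun card_ord -[leLHS]mulr_natl ler_wpM2l //.
have -> : x c = \sum_(u in W) (\prod_(a <- u0) N a)%:R `^ b.
  rewrite /x (eq_bigl [in W]); last by move=> u; rewrite [RHS]inE.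
  by apply: eq_bigr => u /WE ->.
by rewrite sumr_const -[leLHS]mulr_natl.
Qed.

Section Lower.
Context {R : realType} {T A : finType} (theta : T -> A).
Context (f : T -> R -> R) (g : A -> R -> R) (rx ry : R).
Context (Ux Uy : set R) (cx cy ex ey : R) (K : set (R * R)) (B : R).
Hypothesis H : separated_carpet theta f g rx ry Ux Uy cx cy ex ey K B.

Lemma separated_carpet_words (L : nat) : (0 < L)%N ->
  separated_carpet (fun v : L.-tuple T => [tuple of map theta v])
    (fun v x => foldr f x v) (fun u y => foldr g y u) (rx ^+ L) (ry ^+ L)
    Ux Uy cx cy ex ey K B.
Proof.
move=> L0; case: H => rx0 rxy ry1 fsim gsim fsurj gsurj [fU fsep] [gU gsep].
move=> ex0 ey0 Uex Uey Kinv KB; have ry0 := lt_trans rx0 rxy.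
have foldU (I : Type) (h : I -> R -> R) (U : set R) (v : seq I) x :
    (forall i y, U y -> U (h i y)) -> U x -> U (foldr h x v).
  by move=> hU Ux'; elim: v => //= i v IH; exact: hU.
split=> //.
- exact: exprn_gt0.
- by rewrite ltr_pXn2r ?nnegrE ?ltW.
- by rewrite exprn_ilt1 ?gt_eqF // ltW.
- by move=> v; rewrite -{1}(size_tuple v); exact: foldr_similarity.
- by move=> u; rewrite -{1}(size_tuple u); exact: foldr_similarity.
- by move=> v; exact: foldr_surj.
- by move=> v; exact: foldr_surj.
- split=> [v x|v w x y /eqP vw nvw]; first exact: foldU.
  apply: (foldr_separated f rx rx0 fsim (fun d d' => theta d == theta d') Ux) => //.
    by rewrite !size_tuple.
  move: vw => /(congr1 val) /=.
  elim: (val v) (val w) => [|d t IH] [|d' t'] //= [-> /IH ->].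
  by rewrite eqxx.
- split=> [u x|u w x y _ nuw]; first exact: foldU.
  apply: (foldr_separated g ry ry0 gsim (fun _ _ => true) Uy) => //.
    by rewrite !size_tuple.
  have : size u = size w by rewrite !size_tuple.
  by elim: (val u) (val w) => [|? ? IH] [|? ?] //= [/IH].
- by move=> v p Kp; exact: (word_point_in _ _ _ _ _ _ _ _ _ _ _ _ _ H _ Kp v).
Qed.

(** For L = j^2 one has ln (L + 1) <= 2 ln (1 + j) <= 2 j, and j is taken with 2 a < j gap. *)
Lemma ln_succ_sublinear (a gap : R) : 0 <= a -> 0 < gap ->
  exists2 L, (0 < L)%N & a * ln (L.+1)%:R < gap * L%:R.
Proof.
move=> a0 gap0; pose j := (Num.truncn (2 * a / gap)).+1.
have ja : 2 * a < j%:R * gap by rewrite -ltr_pdivrMr // truncnS_gt.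
have j0 : (0 : R) < j%:R by rewrite ltr0n.
exists (j * j)%N => //.
apply: (@le_lt_trans _ _ (a * (2 * j%:R))); last first.
  by rewrite natrM; move: (ltr_pM2r j0 (2 * a) (j%:R * gap)); rewrite ja; lra.
apply: ler_wpM2l => //.
apply: (@le_trans _ _ (ln ((1 + j%:R) ^+ 2))).
  rewrite ler_ln ?posrE ?exprn_gt0 ?ltr0n ?addr_gt0 // -natr1 natrM; nra.
rewrite lnXn ?addr_gt0 // -[leLHS]mulr_natl ler_wpM2l //.
by apply: le_ln1Dx; rewrite (lt_trans _ j0) // ltrN10.
Qed.

Lemma hausdorff_measure_carpet_neq0 (s : R) :
  compact K -> K !=set0 -> (exists a : A, True) ->
  (forall a, 0 < fibre_card theta a)%N -> 0 <= s ->
  s * - ln ry < ln (\sum_a (fibre_card theta a)%:R `^ (ln ry / ln rx)) ->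
  hausdorff_measure euclid_dist s K <> 0%E.
Proof.
move=> cK [p0 Kp0] A0 N0 s0; set b := ln ry / ln rx; set Z := \sum_a _ => sZ.
have rx0 := sc_rx0 H; have ry0 := lt_trans rx0 (sc_rxy H); have ry1 := sc_ry1 H.
have lnry : ln ry < 0 by rewrite ln_lt0 // ry0.
have lnrx : ln rx < 0 by rewrite ln_lt0 // rx0 (lt_trans (sc_rxy H)).
have Z0 : 0 < Z.
  have [a _] := A0; rewrite /Z (bigD1 a) //= ltr_wpDr ?powR_gt0 ?ltr0n //.
  by apply: sumr_ge0 => a' _; exact: powR_ge0.
have gap0 : 0 < ln Z + s * ln ry by lra.
(* L is so long that the polynomial loss (L + 1)^#|A| of the pigeonhole is smaller than the
   exponential gap. *)
have [L L0 LA] := ln_succ_sublinear #|A|%:R _ (ler0n _ _) gap0.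
have [W [n [n0 W0 Wn ZL]]] := uniform_words _ b L A0 N0.
have HL := separated_carpet_words L L0.
have lnX (x : R) : 0 < x -> ln (x ^+ L) = L%:R * ln x :> R.
  by move=> x0; rewrite lnXn // mulr_natl.
have LR0 : (0 : R) < L%:R by rewrite ltr0n.
have M0 : (0 : R) < #|W|%:R by rewrite ltr0n.
have nR0 : (0 : R) < n%:R by rewrite ltr0n.
(* Chosen so that (rx^L)^t1 = 1 / n and (ry^L)^t2 = 1 / #|W|: the weight of a lift within its fibre
   and the weight of a word of W. *)
pose t1 := - ln n%:R / ln (rx ^+ L); pose t2 := - ln #|W|%:R / ln (ry ^+ L).
have powE (x k : R) : 0 < x -> ln x < 0 -> 0 < k ->
    (x ^+ L) `^ (- ln k / ln (x ^+ L)) = k^-1.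
  move=> x0 lx k0; rewrite /powR gt_eqF ?exprn_gt0 // divfK.
    by rewrite expRN lnK.
  by rewrite lnX // lt_eqF // nmulr_llt0.
have rxt : (rx ^+ L) `^ t1 = n%:R^-1 by exact: powE.
have ryt : (ry ^+ L) `^ t2 = #|W|%:R^-1 by exact: powE.
have t_ge0 (x : R) (k : nat) : 0 < x -> ln x < 0 -> (0 < k)%N ->
    0 <= - ln k%:R / ln (x ^+ L).
  move=> x0 lx k0; rewrite mulNr oppr_ge0 nmulr_lle0; last first.
    by rewrite invr_lt0 lnX // nmulr_llt0.
  by rewrite ln_ge0 // ler1n.
have st : s < t1 + t2.
  have lM : ln (#|W|%:R * n%:R `^ b) = ln #|W|%:R + b * ln n%:R :> R.
    by rewrite lnM ?posrE ?powR_gt0 // ln_powR.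
  have : L%:R * ln Z <= #|A|%:R * ln L.+1%:R + (ln #|W|%:R + b * ln n%:R).
    rewrite -lM -lnX // mulr_natl -lnXn ?ltr0n // -natrX.
    rewrite -lnM ?posrE ?mulr_gt0 ?powR_gt0 ?ltr0n ?expn_gt0 //.
    by rewrite ler_ln ?posrE ?exprn_gt0 ?mulr_gt0 ?powR_gt0 ?ltr0n ?expn_gt0.
  have tE : (t1 + t2) * (L%:R * - ln ry) = ln #|W|%:R + b * ln n%:R.
    by rewrite /t1 /t2 /b !lnX //; field; rewrite (lt_eqF lnrx) (lt_eqF lnry) (gt_eqF LR0).
  move=> ZL'; rewrite -(ltr_pM2r (_ : 0 < L%:R * - ln ry)); last first.
    by rewrite mulr_gt0 // oppr_gt0.
  rewrite tE; move: LA ZL'; lra.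
(* The uniform law on the lifts of W; each word of W has exactly n lifts. *)
pose p (v : L.-tuple T) : R :=
  if [tuple of map theta v] \in W then n%:R^-1 * #|W|%:R^-1 else 0.
have p_ge0 v : 0 <= p v by rewrite /p; case: ifP => // _; rewrite mulr_ge0 ?invr_ge0.
have fibreE u : \sum_(v : L.-tuple T | [tuple of map theta v] == u) p v =
    if u \in W then #|W|%:R^-1 else 0.
  rewrite (eq_bigr (fun=> if u \in W then n%:R^-1 * #|W|%:R^-1 else 0)); last first.
    by move=> v /eqP <-.
  rewrite sumr_const card_tuple_fibre; case: ifP => [uW|]; last by rewrite mul0rn.
  by rewrite /fibre_prod (Wn u uW) -[LHS]mulr_natl mulrA divff ?mul1r // gt_eqF.
have p1 : \sum_v p v = 1.
  rewrite (partition_big (fun v : L.-tuple T => [tuple of map theta v]) xpredT) //=.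
  under eq_bigr => u _ do rewrite fibreE.
  by rewrite -big_mkcond /= sumr_const -[LHS]mulr_natl divff // gt_eqF.
pose c := (mass_const (rx ^+ L) (ry ^+ L) ex ey B t1 t2)^-1.
apply: (hausdorff_measure_neq0 K s (t1 + t2) c cK s0 st).
  by rewrite invr_gt0; apply: mass_const_gt0 HL t1 t2.
apply: (mass_distribution _ _ _ _ _ _ _ _ _ _ _ _ _ HL p0 Kp0 p
  (n%:R^-1 * #|W|%:R^-1) #|W|%:R^-1 p_ge0 p1).
- by move=> v; rewrite /p; case: ifP => // _; rewrite mulr_ge0 ?invr_ge0.
- by move=> u; rewrite fibreE; case: ifP => // _; rewrite invr_ge0.
- by rewrite mulr_ge0 ?invr_ge0.
- by rewrite invr_ge0.
- exact: t_ge0.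
- exact: t_ge0.
- by rewrite rxt ryt.
- by rewrite ryt.
Qed.

End Lower.

(** * Upper bound *)

Lemma euclid_dist_le_sum {R : realType} (p q : R * R) :
  euclid_dist p q <= `|p.1 - q.1| + `|p.2 - q.2|.
Proof.
rewrite /euclid_dist -[leRHS]ger0_norm ?addr_ge0 // -sqrtr_sqr ler_wsqrtr //.
rewrite -[(p.1 - q.1) ^+ 2]real_normK ?num_real //.
rewrite -[(p.2 - q.2) ^+ 2]real_normK ?num_real //.
have := mulr_ge0 (normr_ge0 (p.1 - q.1)) (normr_ge0 (p.2 - q.2)).
rewrite !expr2; lra.
Qed.

(** Otherwise r successive drops by more than eps would exceed the total range m. *)
Lemma almost_nondecreasing_step {R : realType} (a : nat -> R) (m eps : R)
    (r : nat) :
  (forall j, 0 <= a j <= m) -> m < r%:R * eps ->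
  exists2 j, (j < r)%N & a j - eps <= a j.+1.
Proof.
move=> am mr; apply: contrapT => no.
have lt j : (j < r)%N -> a j.+1 < a j - eps.
  by move=> jr; rewrite ltNge; apply/negP => ja; apply: no; exists j.
have desc j : (j <= r)%N -> a j <= a 0%N - j%:R * eps.
  elim: j => [_|j IH jr]; first by rewrite mul0r subr0.
  by have := lt j jr; have := IH (ltnW jr); rewrite -natr1 mulrDl; lra.
have := desc r (leqnn r); have := am r; have := am 0%N; lra.
Qed.

(** The denominator a + 1 also covers a = 0. *)
Lemma mul_le_of_lt_div {R : realType} (a x e : R) : 0 <= a -> 0 <= x ->
  x < e / (a + 1) -> a * x <= e.
Proof.
move=> a0 x0; rewrite ltr_pdivlMr ?ltr_wpDl // mulrDr mulr1 mulrC => /ltW.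
by apply: le_trans; rewrite lerDl.
Qed.

Section Upper.
Context {R : realType} {T A : finType} (theta : T -> A).
Context (f : T -> R -> R) (g : A -> R -> R) (rx ry : R).
Context (Ux Uy : set R) (cx cy ex ey : R) (K : set (R * R)) (B : R).
Hypothesis H : separated_carpet theta f g rx ry Ux Uy cx cy ex ey K B.
Hypothesis Kcov : forall p, K p ->
  exists d q, K q /\ p = (f d q.1, g (theta d) q.2).
Hypothesis fibre_gt0 : forall a, (0 < fibre_card theta a)%N.
Hypothesis A0 : exists a : A, True.

Let rx0 := sc_rx0 H.
Let ry0 : 0 < ry := lt_trans rx0 (sc_rxy H).
Let ry1 := sc_ry1 H.
Let rx1 : rx < 1 := lt_trans (sc_rxy H) ry1.
Let lnry : ln ry < 0. Proof. by rewrite ln_lt0 // ry0. Qed.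
Let lnrx : ln rx < 0. Proof. by rewrite ln_lt0 // rx0. Qed.

Let b : R := ln ry / ln rx.
Let Z : R := \sum_a (fibre_card theta a)%:R `^ b.

Let b0 : 0 < b. Proof. by rewrite /b nmulr_rgt0 // invr_lt0. Qed.

Let b1 : b < 1.
Proof.
rewrite /b ltr_ndivrMr // mul1r ltr_ln ?posrE //; exact: sc_rxy H.
Qed.

Let Z0 : 0 < Z.
Proof.
have [a _] := A0; rewrite /Z (bigD1 a) //= ltr_wpDr ?powR_gt0 ?ltr0n //.
by apply: sumr_ge0 => a' _; exact: powR_ge0.
Qed.

Lemma word_coding (k : nat) (p : R * R) : K p ->
  exists w q, [/\ size w = k, K q & p = word_point theta f g q w].
Proof.
elim: k p => [|k IH] p Kp.
  by exists [::], p; split; rewrite // /word_point -surjective_pairing.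
have [d [q [Kq ->]]] := Kcov _ Kp; have [w [q' [wk Kq' qE]]] := IH q Kq.
by exists (d :: w), q'; split; rewrite /= ?wk // qE.
Qed.

Let logN (a : A) : R := ln (fibre_card theta a)%:R.
Let p (d : T) : R := expR ((b - 1) * logN (theta d) - ln Z).
Let q (a : A) : R := expR (b * logN a - ln Z).

Let sum_q : \sum_a q a = 1.
Proof.
have -> : \sum_a q a = \sum_a (fibre_card theta a)%:R `^ b * Z^-1.
  apply: eq_bigr => a _; rewrite /q expRD expRN lnK ?posrE //.
  by rewrite /powR gt_eqF // ltr0n.
by rewrite -mulr_suml -/Z divff // gt_eqF.
Qed.

Let sum_p : \sum_d p d = 1.
Proof.
rewrite -sum_q (partition_big theta xpredT) //=; apply: eq_bigr => a _.
rewrite (eq_bigr (fun=> expR ((b - 1) * logN a - ln Z))); last first.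
  by move=> d /eqP <-.
rewrite sumr_const -[LHS]mulr_natl -/(fibre_card theta a).
rewrite -[X in X * _ = _]lnK ?posrE ?ltr0n // -expRD; congr expR.
by rewrite -/(logN a); ring.
Qed.

Definition square_weight (v : seq T) (c : seq A) : R :=
  (\prod_(d <- v) p d) * (\prod_(a <- c) q a).

Lemma sum_square_weight (l j : nat) :
  \sum_(vc : l.-tuple T * j.-tuple A) square_weight vc.1 vc.2 = 1.
Proof.
rewrite -(pair_bigA _ (fun (v : l.-tuple T) (c : j.-tuple A) => square_weight v c)) /=.
under eq_bigr => v _ do rewrite /square_weight -mulr_sumr sum_tuple_prod_cst sum_q expr1n mulr1.
by rewrite sum_tuple_prod_cst sum_p expr1n.
Qed.

(** Markov's inequality for weights of total 1. *)
Lemma heavy_squares_count (l j : nat) (tau : R) : 0 < tau ->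
  #|[pred vc : l.-tuple T * j.-tuple A | tau <= square_weight vc.1 vc.2]|%:R
    <= tau^-1.
Proof.
move=> tau0; rewrite -div1r ler_pdivlMr // -[leRHS](sum_square_weight l j).
rewrite mulr_natl -sumr_const.
rewrite [leRHS](bigID [pred vc : l.-tuple T * j.-tuple A | tau <= square_weight vc.1 vc.2]) /=.
apply: ler_wpDr; last exact: ler_sum.
by apply: sumr_ge0 => vc _; apply: mulr_ge0; apply: prodr_ge0 => ? _; exact: expR_ge0.
Qed.

(* The weak level whose height matches the width of the strong level [l]. *)
Definition next_level (l : nat) : nat := (Num.truncn (l%:R / b)).+1.

(** With k the next level, l < b k <= l + b. Since ry = rx^b, the two inequalities compare ry^k with
    rx^l from both sides; b < 1 gives l < k. *)
Lemma next_levelP (l : nat) :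
  [/\ (l < next_level l)%N, l%:R < b * (next_level l)%:R,
      ry ^+ next_level l <= rx ^+ l & rx ^+ l * ry <= ry ^+ next_level l].
Proof.
have lb0 : 0 <= l%:R / b by rewrite divr_ge0 // ltW.
have lt1 : l%:R < b * (next_level l)%:R by rewrite mulrC -ltr_pdivrMr // truncnS_gt.
have le1 : b * (next_level l)%:R <= l%:R + b.
  rewrite -natr1 mulrDr mulr1 lerD2r mulrC -ler_pdivlMr //.
  by have /andP[] := truncn_itv lb0.
have powE (x : R) (k : nat) : 0 < x -> x ^+ k = expR (k%:R * ln x).
  by move=> x0; rewrite mulr_natl -lnXn // lnK // posrE exprn_gt0.
have bE : ln ry = b * ln rx by rewrite /b divfK // lt_eqF.
split=> //.
- rewrite -(ltr_nat R); apply: lt_le_trans lt1 _.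
  by rewrite ler_piMl // ltW.
- rewrite !powE // ler_expR bE mulrA (mulrC _ b).
  by apply: ler_wnM2r; exact: ltW.
- rewrite !powE // -[X in _ * X]lnK ?posrE // -expRD ler_expR bE.
  by rewrite mulrA (mulrC _ b) -mulrDl; apply: ler_wnM2r => //; exact: ltW.
Qed.

(** The two tails range independently over intervals that contain the projections of K, so this is a
    full rectangle around the approximate square. *)
Definition square_set (v : seq T) (c : seq A) : set (R * R) :=
  [set z | exists x y, [/\ `|x - cx| <= B, `|y - cy| <= B &
    z = (foldr f x v, foldr g y (map theta v ++ c))]].

Lemma square_set_diam (l k : nat) (v : seq T) (c : seq A) z z' :
  size v = l -> (size v + size c)%N = k -> ry ^+ k <= rx ^+ l ->
  square_set v c z -> square_set v c z' ->
  euclid_dist z z' <= 4 * `|B| * rx ^+ l.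
Proof.
move=> vl vck kl [x [y [xB yB ->]]] [x' [y' [xB' yB' ->]]].
apply: le_trans (euclid_dist_le_sum _ _) _ => /=.
rewrite (foldr_similarity f rx (sc_fsim H) v) vl.
rewrite (foldr_similarity g ry (sc_gsim H)) size_cat size_map vck.
have diamB (u u' o : R) : `|u - o| <= B -> `|u' - o| <= B -> `|u - u'| <= 2 * `|B|.
  by have := ler_norm B; rewrite !ler_norml; lra.
have h1 := diamB _ _ _ xB xB'; have h2 := diamB _ _ _ yB yB'.
have rl0 : 0 < rx ^+ l by exact: exprn_gt0.
have := ler_pM (ltW rl0) (normr_ge0 _) (lexx _) h1.
have := ler_pM (exprn_ge0 k (ltW ry0)) (normr_ge0 _) kl h2.
lra.
Qed.

Definition log_sum (w : seq T) : R := \sum_(d <- w) logN (theta d).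

(** Each of the first l letters enters with exponent b - 1, each later one with b, and all k with a
    factor 1 / Z. *)
Lemma square_weightE (l k : nat) (w : seq T) : (l <= k)%N -> (k <= size w)%N ->
  square_weight (take l w) (map theta (take (k - l) (drop l w))) =
    expR (b * log_sum (take k w) - log_sum (take l w) - k%:R * ln Z).
Proof.
move=> lk kw; rewrite /square_weight big_map -!expR_sum -expRD; congr expR.
rewrite !sumrB -!mulr_sumr -!/(log_sum _) !big_const_seq !count_predT !iter_addr_0.
rewrite !size_takel ?size_drop ?leq_sub2r ?(leq_trans lk kw) //.
have -> : take k w = take l w ++ take (k - l) (drop l w).
  by rewrite -[in LHS](subnKC lk) takeD.
rewrite [log_sum (_ ++ _)]big_cat /= -!/(log_sum _) -![ln Z *+ _]mulr_natl natrB //; ring.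
Qed.

Let logN_ge0 a : 0 <= logN a.
Proof. by rewrite ln_ge0 // ler1n. Qed.

Lemma log_sum_bounds (w : seq T) :
  0 <= log_sum w <= (size w)%:R * ln #|T|%:R.
Proof.
rewrite /log_sum; apply/andP; split; first exact: sumr_ge0.
rewrite -sum1_size natr_sum mulr_suml; apply: ler_sum => d _; rewrite mul1r.
by rewrite ler_ln ?posrE ?ltr0n ?ler_nat ?max_card //; apply/card_gt0P; exists d.
Qed.

Lemma K_covered_by_heavy_squares (l0 r : nat) (eps : R) (z : R * R) :
  (0 < l0)%N -> ln #|T|%:R < r%:R * eps -> K z ->
  exists2 j, (j < r)%N & let l := iter j next_level l0 in
    exists vc : l.-tuple T * (next_level l - l).-tuple A,
      expR (- ((next_level l)%:R * (ln Z + b * eps))) <= square_weight vc.1 vc.2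
      /\ square_set vc.1 vc.2 z.
Proof.
move=> l00 reps Kz; pose lev j := iter j next_level l0.
have lev_gt0 j : (0 < lev j)%N by case: j.
(* Length [lev r] serves every candidate j < r, whose square uses the letters up to [lev j.+1]. *)
have [w [z0 [wr Kz0 ->]]] := word_coding (lev r) z Kz.
have lev_le i j : (i <= j)%N -> (lev i <= lev j)%N.
  move=> /subnK <-; elim: (j - i)%N => // k IH; apply: leq_trans IH _.
  by rewrite addSn /=; have [/ltnW] := next_levelP (lev (k + i)).
have [j jr stepj] : exists2 j, (j < r)%N &
    log_sum (take (lev j) w) / (lev j)%:R - eps <=
    log_sum (take (lev j.+1) w) / (lev j.+1)%:R.
  apply: almost_nondecreasing_step reps => j.
  have lj0 : (0 : R) < (lev j)%:R by rewrite ltr0n.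
  have /andP[h1 h2] := log_sum_bounds (take (lev j) w).
  rewrite divr_ge0 ?(ltW lj0) //= ler_pdivrMr // mulrC; apply: le_trans h2 _.
  rewrite ler_wpM2r ?ler_nat ?size_take_min ?geq_minl //.
  by have [->|T0] := posnP #|T|; [rewrite ln0|rewrite ln_ge0 ?ler1n].
exists j => // l; set k := next_level l.
have kw : (k <= size w)%N by rewrite wr; exact: (lev_le j.+1 r).
have [/ltnW lk lbk kl _] := next_levelP l; rewrite -/k in lk lbk kl.
have lw : (l <= size w)%N by exact: leq_trans kw.
have sv : size (take l w) == l by rewrite size_takel.
have sc : size (map theta (take (k - l) (drop l w))) == (k - l)%N.
  by rewrite size_map size_takel // size_drop leq_sub2r.
exists (Tuple sv, Tuple sc); split => /=.
  rewrite square_weightE // ler_expR.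
  have := stepj; rewrite -/(lev j.+1) (_ : lev j.+1 = k) // -/l.
  rewrite (_ : lev j = l) //; set Sl := log_sum _; set Sk := log_sum _ => hS.
  have l_gt0 : (0 : R) < l%:R by rewrite ltr0n; exact: lev_gt0.
  have k_gt0 : (0 : R) < k%:R by rewrite ltr0n.
  have Sl0 : 0 <= Sl by have /andP[] := log_sum_bounds (take l w).
  have hS' : k%:R * (Sl / l%:R - eps) <= Sk by rewrite mulrC -ler_pdivlMr.
  (* As l < b k and Sl >= 0, the term b Sk outweighs Sl up to the loss b k eps. *)
  have h3 : Sl <= b * k%:R * (Sl / l%:R).
    rewrite mulrA ler_pdivlMr // mulrC; apply: ler_wpM2r => //; exact: ltW.
  have hb : b * (k%:R * (Sl / l%:R - eps)) <= b * Sk by rewrite ler_pM2l.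
  rewrite mulrDr opprD addrC lerD2r lerBrDr; apply: le_trans hb.
  have -> : b * (k%:R * (Sl / l%:R - eps)) =
      - (k%:R * (b * eps)) + b * k%:R * (Sl / l%:R) by ring.
  by rewrite lerD2l.
exists (word_point theta f g z0 (drop l w)).1, (word_point theta f g z0 (drop k w)).2.
have KBw u := sc_KB H _ (word_point_in _ _ _ _ _ _ _ _ _ _ _ _ _ H _ Kz0 u).
split; [by have [] := KBw (drop l w)|by have [] := KBw (drop k w)|].
rewrite /word_point /= -map_cat -takeD subnKC // -!foldr_cat -map_cat.
by rewrite !cat_take_drop.
Qed.

(** The heavy squares ending at level k number at most exp (k (ln Z + b eps)) and have diameter at
    most a constant times ry^k, so their s-th powers add up to at most C exp (- k gap / 2). *)
Lemma hausdorff_measure_carpet_eq0 (s : R) : 0 <= s ->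
  ln Z < s * - ln ry -> hausdorff_measure euclid_dist s K = 0%E.
Proof.
move=> s0 Zs; apply: hausdorff_measure_eq0 => //; first exact: euclid_dist_xx.
move=> delta e delta0 e0.
pose gap := s * - ln ry - ln Z; have gap0 : 0 < gap by rewrite subr_gt0.
(* Then b eps = gap / 2, so the count of squares uses up half of the gap. *)
pose eps := gap / (2 * b); have eps0 : 0 < eps by apply: divr_gt0 => //; apply: mulr_gt0.
pose r := (Num.truncn (ln #|T|%:R / eps)).+1.
have reps : ln #|T|%:R < r%:R * eps by rewrite -ltr_pdivrMr // truncnS_gt.
pose D : R := 4 * `|B|; have D0 : 0 <= D by exact: mulr_ge0.
pose C : R := (D / ry) `^ s; have C0 : 0 <= C by exact: powR_ge0.
pose x : R := expR (- (gap / 2)).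
have x0 : 0 < x by exact: expR_gt0.
have x1 : x < 1 by rewrite expR_lt1; lra.
have rC0 : 0 < r%:R * C + 1 by rewrite ltr_wpDl // mulr_ge0.
have D10 : 0 < D + 1 by rewrite ltr_wpDl.
have [n1 n1P] := exprn_lt_eventually _ _ rx0 rx1 (divr_gt0 delta0 D10).
have [n2 n2P] := exprn_lt_eventually _ _ x0 x1 (divr_gt0 e0 rC0).
(* Beyond [n1] the diameters are at most delta; beyond [n2] the total over the r levels is at most
   e. *)
pose l0 := (n1 + n2).+1; pose lev j := iter j next_level l0.
have l0_le j : (l0 <= lev j)%N.
  elim: j => // j IH; apply: leq_trans IH _; rewrite /lev /=.
  by have [/ltnW] := next_levelP (iter j next_level l0).
have Drx j : D * rx ^+ lev j <= delta.
  apply: mul_le_of_lt_div => //; first by rewrite exprn_ge0 // ltW.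
  by apply: n1P; apply: leq_trans (l0_le j); rewrite /l0 -addnS leq_addr.
pose J (j : 'I_r) := ((lev j).-tuple T * (lev j.+1 - lev j).-tuple A)%type : finType.
pose tau j := expR (- ((lev j.+1)%:R * (ln Z + b * eps))).
(* The good level depends on the point, so the cover gathers the heavy squares of all r levels. *)
exists {j : 'I_r & J j},
  (fun i : {j : 'I_r & J j} => tau (tag i) <= square_weight (tagged i).1 (tagged i).2),
  (fun i : {j : 'I_r & J j} => square_set (tagged i).1 (tagged i).2),
  (fun i : {j : 'I_r & J j} => D * rx ^+ lev (tag i)); split.
- move=> z Kz.
  have [j jr [vc [vcw vcz]]] := K_covered_by_heavy_squares l0 r eps z isT reps Kz.
  by exists (Tagged J (i := Ordinal jr) vc).
- by move=> i _; rewrite Drx mulr_ge0 // exprn_ge0 // ltW.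
- move=> [j [v c]] z z' _ /= zV zV'.
  have [/ltnW ll _ ry_rx _] := next_levelP (lev j).
  apply: (square_set_diam (lev j) (lev j.+1) v c) => //.
    exact: size_tuple.
  by rewrite !size_tuple subnKC.
rewrite -(@sig_big_dep _ _ _ _ J xpredT (fun j vc => tau j <= square_weight vc.1 vc.2)
  (fun j _ => (D * rx ^+ lev j) `^ s)) /=.
apply: (@le_trans _ _ (\sum_(j < r) C * x ^+ l0)).
  apply: ler_sum => j _; rewrite sumr_const -[leLHS]mulr_natl.
  have [_ _ _ rx_ry] := next_levelP (lev j).
  have lev0 : (l0 <= lev j.+1)%N by exact: l0_le.
  apply: (@le_trans _ _ ((tau j)^-1 * (C * (ry ^+ lev j.+1) `^ s))).
    apply: ler_pM; rewrite ?powR_ge0 //; first by apply: heavy_squares_count; exact: expR_gt0.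
    rewrite /C -powRM ?divr_ge0 ?exprn_ge0 ?(ltW ry0) //.
    apply: ge0_ler_powR; rewrite ?nnegrE ?mulr_ge0 ?exprn_ge0 ?invr_ge0 ?(ltW ry0) ?(ltW rx0) //.
    by rewrite -mulrA ler_wpM2l // mulrC ler_pdivlMr.
  rewrite mulrCA ler_wpM2l // /tau -expRN opprK.
  rewrite -powR_mulrn ?(ltW ry0) // -powRrM /powR gt_eqF // -expRD.
  rewrite /x -expRM_natl ler_expR.
  have -> : b * eps = gap / 2 by rewrite /eps; field; rewrite gt_eqF.
  have -> : (lev j.+1)%:R * (ln Z + gap / 2) + (lev j.+1)%:R * s * ln ry =
    (lev j.+1)%:R * - (gap / 2) by rewrite /gap; field.
  by rewrite ler_wnM2r ?ler_nat // oppr_le0 divr_ge0 // ltW.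
rewrite sumr_const card_ord -[leLHS]mulr_natl mulrA.
apply: mul_le_of_lt_div; [exact: mulr_ge0|by rewrite exprn_ge0 // ltW|].
by apply: n2P; rewrite /l0 -addSn leq_addl.
Qed.

End Upper.

(** * Signed carpets *)

Section SignedMaps.
Context {R : realType} {n m : nat}.
Implicit Types (d : 'I_n * 'I_m).

(** An affine form of the shift, so that linear arithmetic handles both signs. *)
Lemma digit_shiftE (e : R) (k : nat) : is_sign e ->
  digit_shift e k = k%:R + (1 - e) / 2.
Proof.
rewrite /digit_shift => -[->|->]; last by rewrite eqxx; lra.
have /negbTE -> : (-1 : R) != 1 by rewrite lt_eqF // (lt_trans (ltrN10 _)).
by rewrite -natr1; lra.
Qed.

Lemma strong_map_similarity (sigma : 'I_n * 'I_m -> R) d :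
  is_sign (sigma d) -> is_similarity n%:R^-1 (strong_map sigma d).
Proof.
move=> sd x y; rewrite /strong_map -mulrBl normrM [RHS]mulrC normfV normr_nat.
congr (_ * _); rewrite opprD addrACA subrr addr0 -mulrBr normrM.
by case: sd => ->; rewrite ?normrN normr1 mul1r.
Qed.

Lemma signed_affine_surj (e b : R) (k : nat) (y : R) : (0 < k)%N -> is_sign e ->
  exists x, (e * x + b) / k%:R = y.
Proof.
move=> k0 se; exists (e * (k%:R * y - b)).
have -> : e * (e * (k%:R * y - b)) = k%:R * y - b by case: se => ->; ring.
by rewrite subrK mulrC mulKf // pnatr_eq0 -lt0n.
Qed.

Lemma strong_map_itv (sigma : 'I_n * 'I_m -> R) d x : is_sign (sigma d) ->
  0 < x < 1 -> d.1%:R < n%:R * strong_map sigma d x < d.1.+1%:R.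
Proof.
move=> sd x01; have n0 : (0 < n)%N by case: n d {sd} => [[[]]|].
rewrite /strong_map mulrC divfK ?pnatr_eq0 -?lt0n // digit_shiftE //.
by rewrite -[d.1.+1%:R]natr1; case: sd => ->; lra.
Qed.

(** Multiplied by m, the values at 0 and 1 add up to 2 j + 1 for either sign, and so determine the
    row j. *)
Lemma weak_map_inj (eta : 'I_n * 'I_m -> R) d d' :
  is_sign (eta d) -> is_sign (eta d') -> weak_map eta d = weak_map eta d' ->
  d.2 = d'.2.
Proof.
move=> sd sd' E; apply/val_inj/eqP; rewrite -(eqr_nat R).
have m0 : (0 : R) < m%:R by rewrite ltr0n; case: m d {sd sd' E} d' => [[_ []]|].
have shiftE y : eta d * y + digit_shift (eta d) d.2 =
    eta d' * y + digit_shift (eta d') d'.2.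
  apply: (mulIf (invr_neq0 (lt0r_neq0 m0))).
  by have := congr1 (fun h => h y) E.
have := shiftE 0; have := shiftE 1; rewrite !digit_shiftE // => h1 h0.
by apply/eqP; lra.
Qed.

End SignedMaps.

(** * The dimension formula *)

Theorem proposition2p2 (R : realType) (n m : nat)
    (hm : (2 <= m)%N) (hmn : (m < n)%N)
    (D : {set 'I_n * 'I_m}) (hD : D != finset.set0)
    (sigma eta : 'I_n * 'I_m -> R)
    (hsigma : forall d, d \in D -> is_sign (sigma d))
    (heta : forall d, d \in D -> is_sign (eta d))
    (K : set (R * R)) (hK : signed_carpet D sigma eta K)
    (A : finType) (theta : 'I_n * 'I_m -> A)
    (htheta : separated_weak_factor D eta theta) :
  let beta : R := ln m%:R / ln n%:R in
  let N (a : A) : nat := #|[set d in D | theta d == a]%SET| in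
  hausdorff_dim euclid_dist K =
    ((ln m%:R)^-1 * ln (\sum_(a : A) (N a)%:R `^ beta))%:E.
Proof.
move=> beta N.
have [thetaA [g [gsim gE [U [U0 _ oU gU gsep]]]]] := htheta.
have [K0 cK KE] := hK.
(* The digits of D become the whole alphabet, as the general results sum over a full finite type. *)
pose T : finType := {d | d \in D}.
pose theta' (t : T) := theta (val t).
pose f (t : T) := strong_map sigma (val t).
have m0 : (0 : R) < m%:R by rewrite ltr0n (leq_trans _ hm).
have mR : (m%:R : R) < n%:R by rewrite ltr_nat.
have m1 : (1 : R) < m%:R by rewrite ltr1n.
have n0 : (0 : R) < n%:R by exact: lt_trans mR.
have NE a : fibre_card theta' a = N a.
  rewrite /fibre_card /N -(card_imset _ val_inj) cardsE /=.
  apply: eq_card => d; apply/imsetP/idP => [[t ta ->]|].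
    by rewrite unfold_in (valP t).
  by rewrite unfold_in => /andP[dD da]; exists (exist _ d dD).
have N0 a : (0 < fibre_card theta' a)%N.
  have : a \in (theta @: D)%SET by rewrite thetaA inE.
  by case/imsetP => d dD ->; apply/card_gt0P; exists (exist _ d dD); rewrite inE.
have A0 : exists a : A, True.
  by have /set0Pn[d _] := hD; exists (theta d).
have [u Uu] := U0.
have [ey /= ey0 Uey] : exists2 e : R, 0 < e & forall y, `|y - u| < e -> U y.
  have /nbhs_ballP[e /= e0 eU] : nbhs u U by exact: open_nbhs_nbhs.
  by exists e => // y yu; apply: eU; rewrite -ball_normE /= distrC.
have [B KB] : exists B : R, forall p, K p -> `|p.1 - 2^-1| <= B /\ `|p.2 - u| <= B.
  have [M [_ MB]] := compact_bounded cK.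
  exists (`|M| + 1 + (2^-1 + `|u|)) => p Kp.
  have pM : `|p| <= `|M| + 1 by apply: MB Kp; rewrite (le_lt_trans (ler_norm M)) // ltrDl.
  have [p1 p2] : `|p.1| <= `|p| /\ `|p.2| <= `|p|.
    by rewrite [`|p|]prod_normE !le_max !lexx orbT.
  have := ler_normB p.1 (2^-1); have := ler_normB p.2 u.
  have : `|2^-1 : R| = 2^-1 by rewrite ger0_norm.
  have := normr_ge0 u; move: p1 p2 pM; split; lra.
have Kmap (t : T) p : K p -> K (f t p.1, g (theta' t) p.2).
  move=> Kp; rewrite KE; exists (val t); first exact: (valP t).
  by exists p => //; rewrite /carpet_map (gE _ (valP t)).
(* Horizontally the unit interval, with centre and radius 1/2; vertically the set of the open set
   condition, with a ball around one of its points. *)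
have H : separated_carpet theta' f g n%:R^-1 m%:R^-1 [set x | 0 < x < 1] U
    2^-1 u 2^-1 ey K B.
  split=> //.
  - by rewrite invr_gt0.
  - by rewrite ltf_pV2 ?posrE.
  - by rewrite invf_lt1.
  - by move=> t; apply: strong_map_similarity; apply: hsigma; exact: valP.
  - move=> t y; apply: signed_affine_surj; last by apply: hsigma; exact: valP.
    by rewrite -(ltr_nat R).
  - move=> a y; have : a \in (theta @: D)%SET by rewrite thetaA inE.
    case/imsetP => d dD ->; rewrite -gE //; apply: signed_affine_surj; last exact: heta.
    by rewrite -(ltr_nat R).
  - split=> [t x /= x01|t t' x y /eqP tt' ntt' /= x01 y01 fxy].
      have := strong_map_itv sigma (val t) x (hsigma _ (valP t)) x01.
      have i1 : (val t).1.+1%:R <= n%:R :> R by rewrite ler_nat.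
      move=> /andP[h1 h2]; apply/andP; split.
        by rewrite -(pmulr_rgt0 _ n0); apply: le_lt_trans h1.
      by rewrite -(ltr_pM2l n0) mulr1; apply: lt_le_trans i1.
    (* Digits with the same weak letter share the weak map, hence the row; if distinct they lie in
       different columns. *)
    have snd : (val t).2 = (val t').2.
      apply: (weak_map_inj eta); rewrite ?gE ?(valP t) ?(valP t') //;
        try (apply: heta; exact: valP).
      by rewrite -/(theta' t) tt'.
    have /andP[h1 h2] := strong_map_itv sigma (val t) x (hsigma _ (valP t)) x01.
    have /andP[h3 h4] := strong_map_itv sigma (val t') y (hsigma _ (valP t')) y01.
    have fxy' : strong_map sigma (val t) x = strong_map sigma (val t') y by exact: fxy.
    move: ntt'; rewrite -val_eqE => /eqP; apply.
    rewrite [LHS]surjective_pairing [RHS]surjective_pairing snd; congr (_, _).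
    rewrite fxy' in h1 h2.
    apply/val_inj/eqP; rewrite /= eqn_leq; apply/andP; split.
      by rewrite -ltnS -(ltr_nat R) (lt_trans h1).
    by rewrite -ltnS -(ltr_nat R) (lt_trans h3).
  - split=> [a x Ux|a a' x y _ aa' Ux Uy gxy]; first by apply: (gU a); exists x.
    have : (g a @` U `&` g a' @` U) (g a x).
      by split; [exists x|exists y; rewrite // gxy].
    by rewrite (gsep a a' aa').
  - by move=> x; rewrite ltr_norml /=; lra.
have Kcov p : K p -> exists (t : T) q, K q /\ p = (f t q.1, g (theta' t) q.2).
  rewrite [in X in X -> _]KE => -[d dD [q Kq <-]]; exists (exist _ d dD), q.
  by split=> //; rewrite /carpet_map gE.
pose Z : R := \sum_(a : A) (N a)%:R `^ beta.
have ZE : \sum_a (fibre_card theta' a)%:R `^ (ln m%:R^-1 / ln n%:R^-1) = Z.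
  rewrite !lnV ?posrE // invrN mulrNN -/beta.
  by apply: eq_bigr => a _; rewrite NE.
have lnm : 0 < ln m%:R :> R by exact: ln_gt0.
have lnn : 0 < ln n%:R :> R by apply: ln_gt0; exact: lt_trans mR.
(* Needed for s0 >= 0, as the dimension is an infimum over nonnegative exponents. *)
have Z1 : 1 <= Z.
  have [a _] := A0; rewrite /Z (bigD1 a) //= ler_wpDr //.
    by apply: sumr_ge0 => a' _; exact: powR_ge0.
  rewrite -[leLHS](powRr0 (N a)%:R) ler_powR ?ler1n -?NE //.
  by rewrite divr_ge0 // ltW.
set s0 := _^-1 * _; have s00 : 0 <= s0 by rewrite mulr_ge0 ?invr_ge0 ?(ltW lnm) ?ln_ge0.
have s0E s : (s0 < s) = (ln Z < s * - ln m%:R^-1).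
  by rewrite lnV ?posrE // opprK /s0 mulrC ltr_pdivrMr.
have s0E' s : (s < s0) = (s * - ln m%:R^-1 < ln Z).
  by rewrite lnV ?posrE // opprK /s0 mulrC ltr_pdivlMr.
apply/eqP; rewrite eq_le; apply/andP; split.
  apply/lee_addgt0Pr => e e0; apply: ereal_inf_lbound; exists (s0 + e) => //.
  split; first by rewrite addr_ge0 // ltW.
  apply: (hausdorff_measure_carpet_eq0 _ _ _ _ _ _ _ _ _ _ _ _ _ H Kcov N0 A0).
    by rewrite addr_ge0 // ltW.
  by rewrite ZE -s0E ltrDl.
apply: le_ereal_inf_tmp => _ [s [s_ge0 Hs] <-]; rewrite lee_fin leNgt; apply/negP => ss0.
apply: (hausdorff_measure_carpet_neq0 _ _ _ _ _ _ _ _ _ _ _ _ _ H s cK K0 A0 N0 s_ge0 _ Hs).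
by rewrite ZE -s0E'.
Qed.
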